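(* Let $c$ be a cost function on $(\mathbb{R}^n)^N$, $\alpha_i>0$, and $(\Phi_1,\dots,\Phi_N)$ an admissible tuple with $0<\int e^{-\alpha_i\Phi_i}dx<\infty$ for all $i$. Let $\mu_i=e^{-\alpha_i\Phi_i(x_i)}dx_i/\int e^{-\alpha_i\Phi_i}dx_i$ and $d(x)=\sum_{i}\Phi_i(x_i)-c(x)$. Assume that for every tuple of probability measures $\nu_1,\dots,\nu_N$ on $\mathbb{R}^n$, $$K^{\min}_d(\nu_1,\dots,\nu_N)\le\sum_{i=1}^N\frac1{\alpha_i}\mathrm{Ent}_{\mu_i}(\nu_i).$$ Then $\prod_i(\int e^{-\alpha_iV_i}dx)^{1/\alpha_i}\le\prod_i(\int e^{-\alpha_i\Phi_i}dx)^{1/\alpha_i}$ for every admissible tuple $(V_i)$ with $0<\int e^{-\alpha_iV_i}dx<\infty$ and $V_i,\Phi_i\in L^1(\nu_i)$, where $\nu_i=e^{-\alpha_iV_i}dx/\int e^{-\alpha_iV_i}dx$; i.e. $(\Phi_i)$ maximizes the functional $\mathcal{BS}_{\alpha,m}$ with Lebesgue reference measures $m_i=dx_i$ over such tuples.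
   Context: A tuple $(V_i)$ of functions $V_i:\mathbb{R}^n\to(-\infty,+\infty]$ is admissible (for $c$) if $\sum_iV_i(x_i)\ge c(x)$ for all $x=(x_1,\dots,x_N)\in(\mathbb{R}^n)^N$. $K^{\min}_d(\nu_1,\dots,\nu_N)=\inf_\pi\int d\,d\pi$ over probability measures $\pi$ on $(\mathbb{R}^n)^N$ with marginals $\nu_1,\dots,\nu_N$. $\mathrm{Ent}_\mu(\nu)=\int\rho\log\rho\,d\mu$ if $\nu=\rho\mu$, and $+\infty$ otherwise. *)

(* Defs.v *)
From HB Require Import structures.
From mathcomp Require Import all_boot all_order all_algebra.
From mathcomp Require Import all_classical all_reals all_analysis measurable_realfun.
Set Implicit Arguments. Unset Strict Implicit. Unset Printing Implicit Defensive.
Import Order.TTheory GRing.Theory Num.Theory.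
Local Open Scope classical_set_scope.
Local Open Scope ring_scope.
Local Open Scope ereal_scope.

(* Points of R^n are n-tuples of reals, equipped with the product (Borel)
   sigma-algebra generated by the coordinates; points of (R^n)^N are
   N-tuples of such. *)
Definition Rn (R : realType) (n : nat) : measurableType _ := n.-tuple R.
Definition RnN (R : realType) (n N : nat) : measurableType _ := N.-tuple (Rn R n).

(* lam is Lebesgue measure on R^n: it gives every box with measurable sides
   the product of the (one-dimensional) Lebesgue measures of its sides.
   (This determines lam uniquely on the product sigma-algebra.) *)
Definition is_lebesgue_Rn (R : realType) (n : nat)
  (lam : {measure set (Rn R n) -> \bar R}) : Prop :=
  forall A : 'I_n -> set R, (forall j, measurable (A j)) ->
    lam [set x | forall j, A j (tnth x j)] = \prod_(j < n) lebesgue_measure (A j).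

Definition admissible (R : realType) (n N : nat)
  (c : RnN R n N -> R) (V : 'I_N -> Rn R n -> \bar R) : Prop :=
  forall x : RnN R n N, (c x)%:E <= \sum_(i < N) V i (tnth x i).

Definition no_minfty (R : realType) (T : Type) (f : T -> \bar R) : Prop :=
  forall x, f x != -oo.

Definition Zpart (R : realType) (n : nat) (lam : {measure set (Rn R n) -> \bar R})
  (alpha : R) (V : Rn R n -> \bar R) : \bar R :=
  \int[lam]_x expeR (- (alpha%:E * V x)).

Definition is_coupling (R : realType) (n N : nat)
  (nu : 'I_N -> probability (Rn R n) R) (pi : probability (RnN R n N) R) : Prop :=
  forall (i : 'I_N) (A : set (Rn R n)), measurable A ->
    pi [set x | A (tnth x i)] = nu i A.

Definition Kmin (R : realType) (n N : nat) (dc : RnN R n N -> \bar R)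
  (nu : 'I_N -> probability (Rn R n) R) : \bar R :=
  ereal_inf [set \int[pi]_x dc x | pi in [set pi | is_coupling nu pi]].

Definition xlogx (R : realType) (t : R) : R := if t == 0%R then 0%R else (t * ln t)%R.

Definition is_density (R : realType) d (T : measurableType d)
  (mu nu : {measure set T -> \bar R}) (rho : T -> R) : Prop :=
  [/\ measurable_fun setT rho, (forall x, (0 <= rho x)%R) &
      forall A, measurable A -> nu A = \int[mu]_(x in A) (rho x)%:E].

Definition Ent (R : realType) d (T : measurableType d)
  (mu nu : {measure set T -> \bar R}) : \bar R :=
  match pselect (exists rho, is_density mu nu rho) with
  | left H => \int[mu]_x (xlogx (projT1 (cid H) x))%:E
  | right _ => +oo
  end.

(* Main.v *)
(* Test the transport-entropy inequality on the Gibbs measures nu_i of V_i.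
   Each nu_i has density rho_i = (Z_Phi,i / Z_V,i) e^(alpha_i (Phi_i - V_i))
   with respect to mu_i, so
     Ent_mu_i(nu_i) = alpha_i (int Phi_i dnu_i - int V_i dnu_i)
                      + ln Z_Phi,i - ln Z_V,i.
   On the other hand, admissibility of V gives d(x) >= sum_i (Phi_i - V_i)(x_i),
   so integrating against any coupling,
     K^min_d(nu) >= sum_i int (Phi_i - V_i) dnu_i.
   The integrals cancel and what remains is
     sum_i (ln Z_Phi,i - ln Z_V,i) / alpha_i >= 0,
   the logarithm of the claimed inequality. *)
Require Import Defs.
From HB Require Import structures.
From mathcomp Require Import all_boot all_order all_algebra.
From mathcomp Require Import all_classical all_reals all_analysis measurable_realfun.
From mathcomp Require Import ring lra.
Set Implicit Arguments. Unset Strict Implicit. Unset Printing Implicit Defensive.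
Import Order.TTheory GRing.Theory Num.Theory.
Local Open Scope classical_set_scope.
Local Open Scope ring_scope.
Local Open Scope ereal_scope.

Lemma measurable_expeR (R : realType) : measurable_fun [set: \bar R] (@expeR R).
Proof.
have -> : @expeR R = fun x => if x \is a fin_num then (expR (fine x))%:E
   else if x == +oo then +oo else 0.
  by apply/funext => -[r| |].
apply: measurable_fun_ifT.
- apply: (measurable_fun_bool true); rewrite setTI.
  have := emeasurable_fin_num (@measurableT _ (\bar R)) (@measurable_id _ _ setT).
  by rewrite setTI.
- apply/(measurable_EFinP _ (expR \o fine)).
  apply: measurableT_comp; [exact: measurable_expR| exact: fine_measurable].
- apply: (measurable_fun_ifT (g := cst +oo) (h := cst 0)) => //.
  apply: (measurable_fun_bool true); rewrite setTI.
  have -> : (fun x : \bar R => x == +oo) @^-1` [set true] = [set +oo].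
    by apply/seteqP; split => x /= /eqP.
  exact: emeasurable_set1.
Qed.

Lemma expeR_fin_num (R : realType) (y : \bar R) :
  y != +oo -> expeR y \is a fin_num.
Proof.
move=> yoo; rewrite fin_numE expeR_eqy yoo andbT.
by apply/negP => /eqP H; have := expeR_ge0 y; rewrite H.
Qed.

Lemma xlogxE (R : realType) (t : R) : xlogx t = (t * ln t)%R.
Proof. by rewrite /xlogx; case: eqP => // ->; rewrite mul0r. Qed.

Section density.
Context d (T : measurableType d) (R : realType).
Variables (mu nu : {measure set T -> \bar R}) (g : T -> \bar R).
Hypotheses (g_ge0 : forall x, 0 <= g x)
  (g_fin_num : forall x, g x \is a fin_num) (mg : measurable_fun setT g)
  (nu_density : forall A, measurable A -> nu A = \int[mu]_(x in A) g x).

Import HBNNSimple.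

(* [change_of_variables] of charge.v is stated only for the Radon-Nikodym
   derivative with respect to a sigma-finite measure; here [g] is any density. *)
Lemma ge0_integral_density f E : (forall x, 0 <= f x) ->
    measurable E -> measurable_fun E f ->
  \int[mu]_(x in E) (f x * g x) = \int[nu]_(x in E) f x.
Proof.
move=> f0 mE mf; pose h := nnsfun_approx mE mf.
have -> : \int[nu]_(x in E) f x =
    lim (\int[nu]_(x in E) (EFin \o h n) x @[n --> \oo]).
  have fE x : E x -> f x = lim ((EFin \o h n) x @[n --> \oo]).
    by move=> Ex; apply/esym/cvg_lim => //; exact: cvg_nnsfun_approx.
  under eq_integral => x /[!inE] /fE -> //.
  apply: monotone_convergence => //.
  - move=> n; apply/measurable_EFinP.
    by apply: (measurable_funS measurableT) => //; exact/measurable_funP.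
  - by move=> n x Ex //=; rewrite lee_fin.
  - by move=> x Ex a b ab; rewrite lee_fin; exact/lefP/nd_nnsfun_approx.
have -> : \int[mu]_(x in E) (f \* g) x =
    lim (\int[mu]_(x in E) ((EFin \o h n) \* g) x @[n --> \oo]).
  have fg x : E x -> f x * g x = lim (((EFin \o h n) \* g) x @[n --> \oo]).
    by move=> Ex; apply/esym/cvg_lim => //; apply: cvgeZr;
      [exact: g_fin_num|exact: cvg_nnsfun_approx].
  under eq_integral => x /[!inE] /fg -> //.
  apply: monotone_convergence => [//| | |].
  - move=> n; apply/emeasurable_funM; apply/measurable_funTS => //.
    exact/measurable_EFinP.
  - by move=> n x Ex /=; rewrite mule_ge0 ?lee_fin ?g_ge0.
  - move=> x Ex a b ab /=; rewrite lee_wpmul2r ?lee_fin ?g_ge0//.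
    exact/lefP/nd_nnsfun_approx.
suff simpleE n : \int[mu]_(x in E) ((EFin \o h n) x * g x) =
    \int[nu]_(x in E) (EFin \o h n) x.
  by under eq_fun do rewrite simpleE.
transitivity (\int[nu]_(x in E)
   (\sum_(y \in range (h n)) (y * \1_(h n @^-1` [set y]) x)%:E)); last first.
  by apply: eq_integral => t tE; rewrite /= fimfunE -fsumEFin.
have mindic r : measurable_fun E (fun x => (r * \1_(h n @^-1` [set r]) x)%:E).
  by apply: (measurable_comp measurableT) => //; exact: measurable_funM.
rewrite ge0_integral_fsum//; last by move=> m y Ey; exact: nnfun_muleindic_ge0.
transitivity (\int[mu]_(x in E) (\sum_(y \in range (h n))
    (y * \1_(h n @^-1` [set y]) x)%:E * g x)).
  apply: eq_integral => x xE.
  by rewrite -ge0_mule_fsuml => [|y]; [rewrite fsumEFin // -fimfunE|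
    exact: nnfun_muleindic_ge0].
rewrite ge0_integral_fsum//; last 2 first.
  - by move=> y; apply: emeasurable_funM => //; exact: measurable_funTS.
  - by move=> m y Ey; rewrite mule_ge0 ?g_ge0// nnfun_muleindic_ge0.
apply: eq_fsbigr => r rhn.
under [RHS]eq_integral do rewrite EFinM.
rewrite integralZl_indic_nnsfun => //.
under eq_integral do rewrite EFinM -muleA.
rewrite ge0_integralZl//.
- under eq_integral do rewrite muleC.
  rewrite (eq_integral (g \_ (h n @^-1` [set r]))); last first.
    by move=> x xE; rewrite epatch_indic.
  by rewrite -integral_mkcondr -nu_density// integral_indic// setIC.
- apply: emeasurable_funM; first exact/measurable_EFinP.
  exact/measurable_funTS.
- by move=> t Et; rewrite mule_ge0 ?lee_fin ?g_ge0.
- by move: rhn; rewrite inE => -[t _ <-]; rewrite lee_fin.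
Qed.

Lemma integral_density f : measurable_fun setT f ->
  \int[mu]_x (f x * g x) = \int[nu]_x f x.
Proof.
move=> mf; rewrite integralE [RHS]integralE.
have maxM (f' : T -> \bar R) x : maxe (f' x * g x) 0 = maxe (f' x) 0 * g x.
  rewrite /Order.max; have [fx0|fx0] := leP 0 (f' x).
    by rewrite ltNge mule_ge0 ?g_ge0.
  rewrite mul0e; case: ifPn => //; rewrite -leNgt => H.
  by apply/eqP; rewrite eq_le H mule_le0_ge0 ?g_ge0// ltW.
have -> : (fun x => f x * g x)^\+ = fun x => f^\+ x * g x.
  by apply/funext => x; rewrite !funeposE maxM.
have -> : (fun x => f x * g x)^\- = fun x => f^\- x * g x.
  by apply/funext => x; rewrite !funenegE -mulNe (maxM (fun x => - f x)).
rewrite !ge0_integral_density//.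
- exact: measurable_funeneg.
- exact: measurable_funepos.
Qed.

End density.

Lemma Ent_density d (T : measurableType d) (R : realType)
    (mu : {measure set T -> \bar R}) (nu : {finite_measure set T -> \bar R})
    (rho : T -> R) :
  is_density mu nu rho -> Ent mu nu = \int[mu]_x (xlogx (rho x))%:E.
Proof.
move=> [mrho rho_ge0 nu_rho]; rewrite /Ent; case: pselect => [H|]; last first.
  by case; exists rho.
case: (cid H) => /= rho' [mrho' _ nu_rho'].
have mxlogx (r : T -> R) : measurable_fun setT r ->
    measurable_fun setT (fun x => (xlogx (r x))%:E).
  move=> mr; apply/measurable_EFinP; under eq_fun do rewrite xlogxE.
  exact/measurable_funM/(measurableT_comp (@measurable_ln R)).
have irho : mu.-integrable setT (EFin \o rho).
  apply/integrableP; split; first exact/measurable_EFinP.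
  under eq_integral do rewrite gee0_abs ?lee_fin //.
  by rewrite -nu_rho // ltey_eq fin_num_measure.
have rho_ae : ae_eq mu setT (EFin \o rho) (EFin \o rho').
  apply: integral_ae_eq => //; first exact/measurable_EFinP.
  by move=> E _ mE; rewrite -nu_rho // nu_rho'.
apply: ae_eq_integral => //; [exact: mxlogx|exact: mxlogx|].
by apply: filterS rho_ae => x /[apply] -[->].
Qed.

Section gibbs_entropy.
Context d (T : measurableType d) (R : realType).
Variables (lam : {measure set T -> \bar R}) (a zp zv : R) (P V : T -> \bar R)
  (mu nu : probability T R).

Let gibbs (W : T -> \bar R) (z : R) x := expeR (- (a%:E * W x)) * (z^-1)%:E.

Hypotheses (a_gt0 : (0 < a)%R) (zp_gt0 : (0 < zp)%R) (zv_gt0 : (0 < zv)%R)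
  (mP : measurable_fun setT P) (mV : measurable_fun setT V)
  (P_fin : no_minfty P) (V_fin : no_minfty V)
  (mu_gibbs : forall A, measurable A -> mu A = \int[lam]_(x in A) gibbs P zp x)
  (nu_gibbs : forall A, measurable A -> nu A = \int[lam]_(x in A) gibbs V zv x)
  (iP : nu.-integrable setT P) (iV : nu.-integrable setT V).

Let gibbs_ge0 W z : (0 < z)%R -> forall x, 0 <= gibbs W z x.
Proof.
by move=> z_gt0 x; rewrite mule_ge0 ?expeR_ge0 ?lee_fin ?invr_ge0 ?ltW.
Qed.

Let gibbs_fin_num W z : no_minfty W -> forall x, gibbs W z x \is a fin_num.
Proof.
move=> W_fin x; rewrite fin_numM ?expeR_fin_num //.
by move: (W_fin x); case: (W x) => [r| |] //= _; rewrite gt0_muley ?lte_fin.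
Qed.

Let measurable_expeR_scale (W : T -> \bar R) (k r : R) :
  measurable_fun setT W ->
  measurable_fun setT (fun x => expeR (k%:E * W x) * r%:E).
Proof.
move=> mW; apply: emeasurable_funM => //.
exact/(measurableT_comp (@measurable_expeR R))/measurable_funeM.
Qed.

Let measurable_gibbs W z :
  measurable_fun setT W -> measurable_fun setT (gibbs W z).
Proof.
move=> mW.
rewrite (_ : gibbs W z = fun x => expeR ((- a)%:E * W x) * (z^-1)%:E).
  exact: measurable_expeR_scale.
by apply/funext => x; rewrite /gibbs EFinN mulNe.
Qed.

(* The density of [nu] with respect to [mu]; it vanishes where [P = +oo]
   because [fine +oo = 0]. *)
Let rho x := (fine (gibbs V zv x) * fine (expeR (a%:E * P x) * zp%:E))%R.

Let measurable_rho : measurable_fun setT rho.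
Proof.
apply: measurable_funM; (apply: measurableT_comp; first exact: fine_measurable).
- exact: measurable_gibbs.
- exact: measurable_expeR_scale.
Qed.

Let rho_ge0 x : (0 <= rho x)%R.
Proof.
rewrite mulr_ge0 ?fine_ge0 ?gibbs_ge0 //.
by rewrite mule_ge0 ?expeR_ge0 ?lee_fin ?ltW.
Qed.

Let F := [set x | P x \is a fin_num].

Let measurable_F : measurable F.
Proof. by have := emeasurable_fin_num measurableT mP; rewrite setTI. Qed.

Let nu_setDF A : measurable A -> nu (A `\` F) = 0.
Proof.
move=> mA; have [N [mN N0 sN]] := integrable_ae measurableT iP.
apply/eqP; rewrite eq_le measure_ge0 andbT -N0; apply: le_measure.
- by rewrite inE; exact: measurableD.
- by rewrite inE.
by move=> x [_ Fx]; apply: sN => /(_ I).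
Qed.

Let rho_gibbs x : (rho x)%:E * gibbs P zp x = gibbs V zv x * (\1_F x)%:E.
Proof.
rewrite /rho indicE -[in RHS](fineK (gibbs_fin_num zv V_fin x)) /gibbs.
have := P_fin x; case Px : (P x) => [p| |] //= _.
  rewrite mem_set; last by rewrite /F /= Px.
  rewrite mule1 -!EFinM; congr (_%:E).
  rewrite -[RHS]mulr1 -!mulrA; congr (_ * _)%R.
  have := expR_gt0 (a * p); rewrite expRN => ?; field; rewrite ?gt_eqF //.
rewrite memNset; last by rewrite /F /= Px.
by rewrite mule0 gt0_muley ?lte_fin // /= mul0e mule0.
Qed.

Let rho_density : is_density mu nu rho.
Proof.
split=> // A mA.
rewrite -(@ge0_integral_density _ _ _ lam mu (gibbs P zp)) //; first last.
- exact/measurable_EFinP/measurable_funTS.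
- exact: measurable_gibbs.
- exact: gibbs_fin_num.
- exact: gibbs_ge0.
rewrite (eq_integral (gibbs V zv \_ F)); last first.
  by move=> x _; rewrite epatch_indic /= rho_gibbs.
rewrite -integral_mkcondr -nu_gibbs; last exact: measurableI.
rewrite (measureDI nu mA measurable_F) -[RHS]add0e; congr (_ + _).
exact: nu_setDF.
Qed.

Let ln_rho_ae :
  {ae nu, forall x, (ln (rho x))%:E = a%:E * (P x - V x) + (ln zp - ln zv)%:E}.
Proof.
apply: filterS2 (integrable_ae measurableT iP) (integrable_ae measurableT iV).
move=> x /(_ I) + /(_ I); rewrite /rho /gibbs.
case: (P x) => // p _; case: (V x) => // v _.
rewrite /= -EFinB -!EFinM -EFinD; congr (_%:E).
rewrite lnM ?posrE ?mulr_gt0 ?expR_gt0 ?invr_gt0 //.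
rewrite !lnM ?posrE ?expR_gt0 ?invr_gt0 // !expRK lnV ?posrE //.
lra.
Qed.

Lemma Ent_gibbs :
  Ent mu nu = a%:E * (\int[nu]_x P x - \int[nu]_x V x) + (ln zp - ln zv)%:E.
Proof.
rewrite (Ent_density rho_density).
transitivity (\int[nu]_x (ln (rho x))%:E).
  rewrite -(@integral_density _ _ _ mu nu (EFin \o rho)) //.
  - by apply: eq_integral => x _; rewrite xlogxE EFinM muleC.
  - exact/measurable_EFinP.
  - by case: rho_density.
  - by apply/measurable_EFinP; exact: measurableT_comp (@measurable_ln R) _.
transitivity (\int[nu]_x (a%:E * (P x - V x) + (ln zp - ln zv)%:E)).
  apply: ae_eq_integral => //.
  - by apply/measurable_EFinP; exact: measurableT_comp (@measurable_ln R) _.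
  - by apply: emeasurable_funD => //; exact/measurable_funeM/emeasurable_funB.
  - by apply: filterS ln_rho_ae => x + _.
have iPV : nu.-integrable setT (fun x => a%:E * (P x - V x)).
  exact/integrableZl/integrableB.
rewrite integralD //; last exact: finite_measure_integrable_cst.
rewrite integralZl //; last exact: integrableB.
rewrite integralB // integral_cst // -[in RHS](mule1 (_ - _)%:E).
by congr (_ + _ * _); exact: probability_setT.
Qed.

End gibbs_entropy.

Lemma le_integral_integrable_minorant d (T : measurableType d) (R : realType)
    (mu : {measure set T -> \bar R}) (f g : T -> \bar R) :
  mu.-integrable setT g -> measurable_fun setT f ->
  (forall x, g x <= f x) -> \int[mu]_x g x <= \int[mu]_x f x.
Proof.
move=> ig mf gf; have mg := measurable_int mu ig.
rewrite integralE [X in _ <= X]integralE; apply: leeB.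
- apply: ge0_le_integral => //; [exact: measurable_funepos..|].
  move=> x _; apply: (funepos_le (D := setT)) => [y _|]; first exact: gf.
  exact: in_setT.
- apply: ge0_le_integral => //; [exact: measurable_funeneg..|].
  move=> x _; apply: (funeneg_le (D := setT)) => [y _|]; first exact: gf.
  exact: in_setT.
Qed.

Section image_measure.
Context d1 d2 (X : measurableType d1) (Y : measurableType d2) (R : realType).
Variables (pi : {measure set X -> \bar R}) (nu : {measure set Y -> \bar R})
  (phi : X -> Y) (h : Y -> \bar R).
Hypotheses (mphi : measurable_fun setT phi)
  (nu_image : forall A, measurable A -> nu A = pi (phi @^-1` A))
  (ih : nu.-integrable setT h).

Let mh : measurable_fun setT h := measurable_int nu ih.

Let integral_pushforwardE (f : Y -> \bar R) :
  \int[nu]_y f y = \int[pushforward pi phi]_y f y.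
Proof. by apply: eq_measure_integral => A mA _; exact: nu_image. Qed.

Lemma integrable_comp_image : pi.-integrable setT (fun x => h (phi x)).
Proof.
apply/integrableP; split; first exact: measurableT_comp.
have /integrableP[_] := ih; rewrite integral_pushforwardE.
rewrite ge0_integral_pushforward ?preimage_setT //.
exact: measurableT_comp.
Qed.

Lemma integral_comp_image : \int[pi]_x h (phi x) = \int[nu]_y h y.
Proof.
rewrite integral_pushforwardE integral_pushforward ?preimage_setT //.
exact: integrable_comp_image.
Qed.

End image_measure.

Lemma sume_sub_le (R : realType) (I : finType) (a b : I -> \bar R) (c : R) :
  (forall i, b i != -oo) -> c%:E <= \sum_i b i ->
  \sum_i (a i - b i) <= \sum_i a i - (c%:E).
Proof.
move=> b_fin cb; have [[j bj]|] := pselect (exists j, b j = +oo).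
  by rewrite (bigD1 j) //= bj addeNy addNye leNye.
move=> /forallNP b_noo.
have fin_b i : b i \is a fin_num by rewrite fin_numE b_fin; exact/eqP/b_noo.
by rewrite big_split /= fin_num_sumeN //; apply: leeD2l; rewrite EFinN leeN2.
Qed.

Lemma sum_integral_sub_le_Kmin (R : realType) (n N : nat)
    (c : RnN R n N -> R) (Phi V : 'I_N -> Rn R n -> \bar R)
    (nu : 'I_N -> probability (Rn R n) R) :
  measurable_fun setT c -> (forall i, no_minfty (V i)) -> admissible c V ->
  (forall i, (nu i).-integrable setT (Phi i)) ->
  (forall i, (nu i).-integrable setT (V i)) ->
  \sum_(i < N) (\int[nu i]_x Phi i x - \int[nu i]_x V i x)
    <= Kmin (fun x => \sum_(i < N) Phi i (tnth x i) - (c x)%:E) nu.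
Proof.
move=> mc V_fin V_adm iPhi iV; apply/ereal_infP => _ [pi pi_nu <-].
have mtnth i : measurable_fun setT (fun x : RnN R n N => tnth x i).
  exact: measurable_tnth.
have nu_image i A : measurable A -> nu i A = pi ((fun x => tnth x i) @^-1` A).
  by move=> mA; rewrite -pi_nu.
pose h i y := Phi i y - V i y.
have ih i : (nu i).-integrable setT (h i).
  by apply: integrableB; [exact: measurableT|exact: iPhi|exact: iV].
have ihpi i : pi.-integrable setT (fun x => h i (tnth x i)).
  exact: (integrable_comp_image (mtnth i) (nu_image i) (ih i)).
rewrite (eq_bigr (fun i => \int[pi]_x h i (tnth x i))); last first.
  move=> i _; rewrite -integralB //; [symmetry|exact: iPhi|exact: iV].
  exact: (integral_comp_image (mtnth i) (nu_image i) (ih i)).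
rewrite -(integral_sum measurableT ihpi).
apply: le_integral_integrable_minorant.
- exact: integrable_sum.
- apply: emeasurable_funB; last exact/measurable_EFinP.
  apply: emeasurable_sum => i; apply: measurableT_comp (mtnth i).
  exact: measurable_int (iPhi i).
- by move=> x; apply: sume_sub_le => // i; exact: V_fin.
Qed.

Lemma sum_ln_ge0_of_entropy_bound (R : realType) (I : finType)
    (alpha l : I -> R) (u : I -> \bar R) :
  (forall i, 0 < alpha i)%R -> (forall i, u i \is a fin_num) ->
  \sum_i u i <= \sum_i ((alpha i)^-1)%:E * ((alpha i)%:E * u i + (l i)%:E) ->
  (0 <= \sum_i (alpha i)^-1 * l i)%R.
Proof.
move=> alpha_gt0 u_fin.
have -> : u = fun i => (fine (u i))%:E by apply/funext => i; rewrite fineK.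
rewrite [X in _ <= X -> _]
  (eq_bigr (fun i => (fine (u i) + (alpha i)^-1 * l i)%:E)).
  by rewrite !sumEFin lee_fin big_split /= lerDl.
by move=> i _; rewrite -EFinM mulrDr mulrA mulVf ?mul1r // gt_eqF.
Qed.

Lemma prod_powR_le (R : realType) (I : finType) (alpha zv zp : I -> R) :
  (forall i, 0 < zv i)%R -> (forall i, 0 < zp i)%R ->
  (0 <= \sum_i (alpha i)^-1 * (ln (zp i) - ln (zv i)))%R ->
  (\prod_i zv i `^ (alpha i)^-1 <= \prod_i zp i `^ (alpha i)^-1)%R.
Proof.
move=> zv_gt0 zp_gt0 ln_ge0.
have powRE (z : I -> R) i : (0 < z i)%R ->
    (z i `^ (alpha i)^-1 = expR ((alpha i)^-1 * ln (z i)))%R.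
  by move=> z_gt0; rewrite /powR gt_eqF.
rewrite (eq_bigr _ (fun i _ => powRE _ i (zv_gt0 i))).
rewrite (eq_bigr _ (fun i _ => powRE _ i (zp_gt0 i))).
rewrite -!expR_sum ler_expR -subr_ge0 -sumrB.
by under eq_bigr do rewrite -mulrBr.
Qed.

Theorem theorem2p4 (R : realType) (n N : nat)
  (lam : {measure set (Rn R n) -> \bar R}) (Hlam : is_lebesgue_Rn lam)
  (c : RnN R n N -> R) (mc : measurable_fun setT c)
  (alpha : 'I_N -> R) (Halpha : forall i, (0 < alpha i)%R)
  (Phi : 'I_N -> Rn R n -> \bar R)
  (mPhi : forall i, measurable_fun setT (Phi i))
  (Phi_fin : forall i, no_minfty (Phi i))
  (Phi_adm : admissible c Phi)
  (ZPhi : forall i, 0 < Zpart lam (alpha i) (Phi i) < +oo)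
  (mu : 'I_N -> probability (Rn R n) R)
  (Hmu : forall i A, measurable A ->
     mu i A = \int[lam]_(x in A) (expeR (- ((alpha i)%:E * Phi i x)) *
                 ((fine (Zpart lam (alpha i) (Phi i)))^-1)%:E))
  (HT : forall nu : 'I_N -> probability (Rn R n) R,
     Kmin (fun x => \sum_(i < N) Phi i (tnth x i) - (c x)%:E) nu
       <= \sum_(i < N) ((alpha i)^-1)%:E * Ent (mu i) (nu i)) :
  forall V : 'I_N -> Rn R n -> \bar R,
    (forall i, measurable_fun setT (V i)) ->
    (forall i, no_minfty (V i)) ->
    admissible c V ->
    (forall i, 0 < Zpart lam (alpha i) (V i) < +oo) ->
  forall nu : 'I_N -> probability (Rn R n) R,
    (forall i A, measurable A ->
       nu i A = \int[lam]_(x in A) (expeR (- ((alpha i)%:E * V i x)) *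
                   ((fine (Zpart lam (alpha i) (V i)))^-1)%:E)) ->
    (forall i, (nu i).-integrable setT (V i)) ->
    (forall i, (nu i).-integrable setT (Phi i)) ->
  (\prod_(i < N) (fine (Zpart lam (alpha i) (V i))) `^ (alpha i)^-1
     <= \prod_(i < N) (fine (Zpart lam (alpha i) (Phi i))) `^ (alpha i)^-1)%R.
Proof.
move=> V mV V_fin V_adm ZV nu nu_gibbs iV iPhi.
apply: prod_powR_le => [i|i|]; first exact: fine_gt0 (ZV i).
  exact: fine_gt0 (ZPhi i).
apply: (@sum_ln_ge0_of_entropy_bound _ _ alpha _
  (fun i => \int[nu i]_x Phi i x - \int[nu i]_x V i x)) => // [i|].
  by rewrite fin_numB !(integrable_fin_num measurableT) ?iPhi ?iV.
have Ent_nu i : Ent (mu i) (nu i) = (alpha i)%:E *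
    (\int[nu i]_x Phi i x - \int[nu i]_x V i x) +
    (ln (fine (Zpart lam (alpha i) (Phi i))) -
     ln (fine (Zpart lam (alpha i) (V i))))%:E.
  exact: Ent_gibbs (Halpha i) (fine_gt0 (ZPhi i)) (fine_gt0 (ZV i)) (mPhi i)
    (mV i) (Phi_fin i) (V_fin i) (Hmu i) (nu_gibbs i) (iPhi i) (iV i).
apply: le_trans (sum_integral_sub_le_Kmin mc V_fin V_adm iPhi iV) _.
apply: le_trans (HT nu) _.
by under eq_bigr do rewrite Ent_nu.
Qed.
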